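(* Suppose $m,k\in\mathbb{N}$ and $-1<\alpha<0$. The Type III exceptional $X_m$-Laguerre polynomial $L_{m,m+k}^{\mathrm{III},\alpha}(x)$ has $k$ positive roots which interlace the roots of $L_{k-1}^{\alpha+1}(x)$ and $m$ negative roots which interlace the roots of $L_m^{-\alpha-1}(-x)$. More precisely, let $\{x_{k-1,i}^{\alpha+1}\}_{i=1}^{k-1}\subset(0,\infty)$ denote the (simple) roots of $L_{k-1}^{\alpha+1}(x)$, and let $\{z_{m,i}^{-\alpha-1}\}_{i=1}^m\subset(-\infty,0)$ denote the (simple) roots of $L_m^{-\alpha-1}(-x)$, ordered as $$z_{m,m}^{-\alpha-1}<z_{m,m-1}^{-\alpha-1}<\cdots<z_{m,1}^{-\alpha-1}<0<x_{k-1,1}^{\alpha+1}<x_{k-1,2}^{\alpha+1}<\cdots<x_{k-1,k-1}^{\alpha+1}.$$ Then (a) each of the $k$ intervals $$(0,x_{k-1,1}^{\alpha+1}),\ (x_{k-1,1}^{\alpha+1},x_{k-1,2}^{\alpha+1}),\ \ldots,\ (x_{k-1,k-2}^{\alpha+1},x_{k-1,k-1}^{\alpha+1}),\ (x_{k-1,k-1}^{\alpha+1},\infty)$$ contains exactly one root of $L_{m,m+k}^{\mathrm{III},\alpha}$; (b) each of the $m$ intervals $$(-\infty,z_{m,m}^{-\alpha-1}),\ (z_{m,m}^{-\alpha-1},z_{m,m-1}^{-\alpha-1}),\ \ldots,\ (z_{m,2}^{-\alpha-1},z_{m,1}^{-\alpha-1})$$ contains exactly one root of $L_{m,m+k}^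{\mathrm{III},\alpha}$.
   Context: $\mathbb{N}=\{1,2,\dots\}$. For $a\in\mathbb{R}$ and integer $n\ge0$ the classical Laguerre polynomial is $L_n^a(x)=\sum_{j=0}^n\binom{n+a}{n-j}\frac{(-x)^j}{j!}$, with $\binom{r}{i}=r(r-1)\cdots(r-i+1)/i!$; $L_n^a:=0$ for $n<0$. The Type III exceptional $X_m$-Laguerre polynomials are $L_{m,0}^{\mathrm{III},\alpha}(x)=1$ and, for $n\ge m+1$, $$L_{m,n}^{\mathrm{III},\alpha}(x)=xL_{n-m-2}^{\alpha+2}(x)L_m^{-\alpha-1}(-x)+(m+1)L_{n-m-1}^{\alpha+1}(x)L_{m+1}^{-\alpha-2}(-x).$$ When $k=1$ the list of intervals in (a) is the single interval $(0,\infty)$; when $m=1$ the list in (b) is the single interval $(-\infty,z_{1,1}^{-\alpha-1})$. ''Interlace'' is used in the sense made precise by (a) and (b). *)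

(* Defs.v *)
From mathcomp Require Export all_boot all_order all_algebra.
From mathcomp Require Export reals.
From mathcomp Require Export polyrcf.

Set Implicit Arguments.
Unset Strict Implicit.
Unset Printing Implicit Defensive.

Import Order.TTheory GRing.Theory Num.Theory.

Local Open Scope ring_scope.

Definition gbinom (R : fieldType) (r : R) (i : nat) : R :=
  (\prod_(l < i) (r - l%:R)) / (i`!)%:R.

Definition laguerre (R : fieldType) (a : R) (n : int) : {poly R} :=
  if n is Posz d then
    \sum_(j < d.+1) (gbinom (d%:R + a) (d - j) / (j`!)%:R) *: (- 'X) ^+ j
  else 0.

(* The polynomial L_n^a(-x). *)
Definition laguerre_opp (R : fieldType) (a : R) (n : int) : {poly R} :=
  laguerre a n \Po (- 'X).

(* The degree n ranges over 0 and the n >= m + 1.  For 1 <= n <= m, where the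
   family has no member, both Laguerre indices are negative and the value is 0. *)
Definition laguerreIII (R : fieldType) (alpha : R) (m n : nat) : {poly R} :=
  if n == 0%N then 1 else
    'X * laguerre (alpha + 2) (n%:Z - m%:Z - 2) * laguerre_opp (- alpha - 1) m
    + m.+1%:R *: (laguerre (alpha + 1) (n%:Z - m%:Z - 1)
                  * laguerre_opp (- alpha - 2) m.+1).

Definition exactly_one_root (R : realType) (p : {poly R}) (I : interval R) :=
  exists! y : R, y \in I /\ root p y.

(* Main.v *)
Require Import Defs.
From mathcomp Require Import ring lra.
Set Implicit Arguments.
Unset Strict Implicit.
Unset Printing Implicit Defensive.

Import Order.TTheory GRing.Theory Num.Theory.
Local Open Scope ring_scope.

(** Write b = - alpha - 1, L for the Laguerre polynomial of parameter alpha + 1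
    and degree k - 1, and M(x) for the one of parameter b and degree m taken at
    -x.  Since -1 < alpha < 0, both parameters alpha + 1 and b exceed -1 while
    b < 0.  Differentiation sends L_n^a to - L_(n-1)^(a+1), and Laguerre's
    differential equation expresses L_(m+1)^(b-1) through L_m^b and its
    derivative, so the exceptional polynomial takes the form
<<
      P = x (L M' - L' M) + (b + x) L M     (laguerreIII_wronskian).
>>
    At a root x of L this is - x L'(x) M(x), at a root z of M it is
    z L(z) M'(z), and at 0 it is b L(0) M(0) < 0.  As M is positive on
    [0, +oo[ and L on ]-oo, 0], on each side P is, up to positive factors and a
    global sign, the derivative of a polynomial at its own roots: X L at 0 and
    at the roots of L, and M at the roots of M.  The derivative of a
    simple-rooted polynomial alternates in sign along its roots, so P has a root
    between any two consecutive ones, and one more beyond the extreme root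
    because its sign at infinity is the wrong one (root_in_gap).  This gives k
    positive and m negative roots, and P has degree m + k, so there is no room
    for a second root in any interval (roots_pigeonhole).

    The roots of the Laguerre polynomials themselves come from the same
    mechanism, by induction on the degree, all parameters above -1 together
    (laguerre_roots): the differential equation reads
<<
      (n + 1) L_(n+1)^a = x (L_n^(a+1))' + (a + 1 - x) L_n^(a+1),
>>
    so the left-hand side is a positive multiple of (X L_n^(a+1))' at 0 and at
    the roots of L_n^(a+1). *)

(** * Coefficients and differential relations of Laguerre polynomials *)

Lemma natS_neq0 (R : numFieldType) n : n.+1%:R != 0 :> R.
Proof. by rewrite pnatr_eq0. Qed.

Lemma fact_neq0 (R : numFieldType) n : (n`!)%:R != 0 :> R.
Proof. by rewrite pnatr_eq0 -lt0n fact_gt0. Qed.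

Lemma gbinomS (R : numFieldType) (r : R) i :
  i.+1%:R * gbinom r i.+1 = (r - i%:R) * gbinom r i.
Proof.
rewrite /gbinom big_ord_recr /= factS natrM.
have := natS_neq0 R i; have := fact_neq0 R i; move: i.+1%:R i`!%:R => u v.
by move=> v0 u0; field; rewrite u0 v0.
Qed.

Lemma laguerreE (R : fieldType) (a : R) (n : nat) :
  laguerre a n =
  \poly_(j < n.+1) ((-1) ^+ j * gbinom (n%:R + a) (n - j) / (j`!)%:R).
Proof.
rewrite poly_def; apply: eq_bigr => j _.
by rewrite -scaleN1r exprZn scalerA [_ * (-1) ^+ j]mulrC mulrA.
Qed.

Lemma sign_div_fact_neq0 (R : numFieldType) (n : nat) :
  (-1) ^+ n / (n`!)%:R != 0 :> R.
Proof.
by rewrite mulf_neq0 ?signr_eq0 // invr_eq0 fact_neq0.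
Qed.

Lemma gbinom0 (R : fieldType) (r : R) : gbinom r 0 = 1.
Proof. by rewrite /gbinom big_ord0 divr1. Qed.

Lemma size_laguerre (R : numFieldType) (a : R) (n : nat) :
  size (laguerre a n) = n.+1.
Proof.
by rewrite laguerreE size_poly_eq // subnn gbinom0 mulr1 sign_div_fact_neq0.
Qed.

Lemma laguerre_neq0 (R : numFieldType) (a : R) (n : nat) : laguerre a n != 0.
Proof. by rewrite -size_poly_eq0 size_laguerre. Qed.

Lemma lead_coef_laguerre (R : numFieldType) (a : R) (n : nat) :
  lead_coef (laguerre a n) = (-1) ^+ n / (n`!)%:R.
Proof.
rewrite laguerreE lead_coef_poly // subnn gbinom0 mulr1 //.
exact: sign_div_fact_neq0.
Qed.

Lemma deriv_laguerre (R : numFieldType) (a : R) (n : nat) :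
  (laguerre a n.+1)^`() = - laguerre (a + 1) n.
Proof.
apply/polyP => j; rewrite coef_deriv coefN !laguerreE !coef_poly ltnS.
case: ltnP => _; last by rewrite mul0rn oppr0.
rewrite subSS -[n.+1%:R]natr1 -addrA [1 + a]addrC factS natrM exprS.
rewrite -[LHS]mulr_natr.
have := natS_neq0 R j; have := fact_neq0 R j; move: j.+1%:R j`!%:R => u v.
by move=> v0 u0; field; rewrite u0 v0.
Qed.

(** Laguerre's differential equation for L_(n+1)^a, with the derivatives of
    L_(n+1)^a written as Laguerre polynomials of parameter a + 1.  It raises the
    degree while lowering the parameter, and on coefficients it is the recurrence
    [gbinomS]: every binomial involved has upper entry n + 1 + a. *)
Lemma laguerre_rodrigues (R : numFieldType) (a : R) (n : nat) :
  n.+1%:R *: laguerre a n.+1 =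
  'X * (laguerre (a + 1) n)^`() + ((a + 1)%:P - 'X) * laguerre (a + 1) n.
Proof.
apply/polyP => j; rewrite coefZ coefD mulrBl coefB coefCM !coefXM coef_deriv.
rewrite !laguerreE !coef_poly (_ : n.+1%:R + a = n%:R + (a + 1)).
  set r := n%:R + (a + 1); case: j => [|j] /=.
    have := gbinomS r n; rewrite !subn0 expr0 !mul1r divr1 mulrA => ->.
    by rewrite !divr1 add0r subr0 /r addrAC subrr add0r.
  rewrite subSS !ltnS; case: (ltngtP j n) => [jn|jn|->].
  - have := gbinomS r (n - j.+1); rewrite -subSn // subSS.
    rewrite -[_ *+ j.+1]mulr_natr exprS factS natrM natrB ?(ltnW jn) //.
    rewrite natrB //.
    have := natS_neq0 R j; have := fact_neq0 R j.
    rewrite /r -[n.+1%:R]natr1 -[j.+1%:R]natr1.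
    move: (gbinom _ (n - j)) (gbinom _ (n - j.+1)) => g g'.
    move: j%:R n%:R j`!%:R => u v w.
    move=> w0 u0 E; apply: (mulfI (mulf_neq0 u0 w0)); apply/eqP.
    rewrite -subr_eq0; apply/eqP.
    (* with denominators cleared, the difference of the two sides is a multiple of
       the difference of the two sides of E *)
    transitivity
      (- (-1) ^+ j * ((v - u) * g - (v + (a + 1) - (v - (u + 1))) * g')).
      by field; rewrite u0 w0.
    by rewrite E subrr mulr0.
  - by rewrite mul0rn !mulr0 subrr addr0.
  - rewrite subnn mul0rn mulr0 add0r sub0r gbinom0 exprS factS natrM.
    have := natS_neq0 R n; have := fact_neq0 R n.
    by move: n.+1%:R n`!%:R => u v v0 u0; field; rewrite u0 v0.
by rewrite -natr1 -addrA [1 + a]addrC.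
Qed.

(** * Reflection of polynomials and root lists *)

Lemma horner_opp (R : comNzRingType) (p : {poly R}) (x : R) :
  (p \Po (- 'X)).[x] = p.[- x].
Proof. by rewrite horner_comp hornerN hornerX. Qed.

Lemma deriv_comp_opp (R : comNzRingType) (p : {poly R}) :
  (p \Po (- 'X))^`() = - (p^`() \Po (- 'X)).
Proof. by rewrite deriv_comp derivN derivX mulrN1. Qed.

Lemma size_comp_opp (R : idomainType) (p : {poly R}) :
  size (p \Po (- 'X)) = size p.
Proof. by rewrite size_comp_poly2 // size_polyN size_polyX. Qed.

Lemma lead_coef_comp_opp (R : idomainType) (p : {poly R}) :
  lead_coef (p \Po (- 'X)) = lead_coef p * (-1) ^+ (size p).-1.
Proof.
by rewrite lead_coef_comp ?size_polyN ?size_polyX // lead_coefN lead_coefX.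
Qed.

Lemma rootsR_eq (R : rcfType) (p : {poly R}) x :
  p != 0 -> (x \in rootsR p) = root p x.
Proof. by move=> /roots_on_rootsR /(_ x); rewrite in_itv. Qed.

Lemma rootsR_sorted (R : rcfType) (p : {poly R}) : sorted <%R (rootsR p).
Proof. exact: sorted_roots. Qed.

Lemma rootsR_uniq (R : rcfType) (p : {poly R}) : uniq (rootsR p).
Proof. exact: lt_sorted_uniq (rootsR_sorted p). Qed.

Lemma rootsR_prod (R : rcfType) (p : {poly R}) :
  size p = (size (rootsR p)).+1 ->
  p = lead_coef p *: \prod_(t <- rootsR p) ('X - t%:P).
Proof.
move=> sp; have p0 : p != 0 by rewrite -size_poly_eq0 sp.
apply: all_roots_prod_XsubC => //; last by rewrite uniq_rootsE rootsR_uniq.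
by apply/allP => x; rewrite rootsR_eq.
Qed.

Lemma mup_rootsR (R : rcfType) (p : {poly R}) (x : R) :
  size p = (size (rootsR p)).+1 -> x \in rootsR p -> mup x p = 1%N.
Proof.
move=> sp xp; have p0 : lead_coef p != 0.
  by rewrite lead_coef_eq0 -size_poly_eq0 sp.
rewrite {1}(rootsR_prod sp) -mul_polyC mupMr ?rootC ?(negPf p0) //.
by rewrite mu_prod_XsubC count_uniq_mem ?rootsR_uniq ?xp.
Qed.

(** Reflection reverses the order, which is why the roots of M listed from the
    right correspond entry by entry to the positive Laguerre roots. *)
Lemma rev_rootsR_comp_opp (R : rcfType) (p : {poly R}) :
  rev (rootsR (p \Po (- 'X))) = [seq - x | x <- rootsR p].
Proof.
have [->|p0] := eqVneq p 0; first by rewrite comp_poly0 rootsR0.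
have q0 : p \Po (- 'X) != 0.
  by rewrite comp_poly2_eq0 // size_polyN size_polyX.
rewrite -[RHS]revK; congr rev; apply: lt_sorted_eq.
- exact: rootsR_sorted.
- rewrite rev_sorted sorted_map (eq_sorted (e' := <%R)) ?rootsR_sorted //.
  by move=> x y /=; rewrite ltrN2.
move=> x; rewrite rootsR_eq // mem_rev -[x in RHS]opprK mem_map ?rootsR_eq //.
  by rewrite /root horner_comp hornerN hornerX.
exact: oppr_inj.
Qed.

(** * Roots forced by sign alternation *)

(** With ts increasing, the gap of index i lies between two neighbours, or is
    the half-line beyond the last entry, where the default +oo takes over. *)
Definition gap (R : rcfType) (ts : seq R) (i : nat) : interval R :=
  Interval (BRight ts`_i) (nth +oo%O [seq BLeft t | t <- ts] i.+1).

Lemma in_gap (R : rcfType) (ts : seq R) (i : nat) (y : R) :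
  (y \in gap ts i) =
  (ts`_i < y) && ((i.+1 < size ts)%N ==> (y < ts`_i.+1)).
Proof.
rewrite /gap; have [its|its] := ltnP i.+1 (size ts).
  by rewrite (nth_map 0) // in_itv.
by rewrite [nth +oo%O _ _]nth_default ?size_map // in_itv.
Qed.

Lemma gap_disjoint (R : rcfType) (ts : seq R) (i j : nat) (y : R) :
  sorted <%R ts -> (i < size ts)%N -> (j < size ts)%N ->
  y \in gap ts i -> y \in gap ts j -> i = j.
Proof.
move=> ts_lt; wlog ij : i j / (i < j)%N => [H|] its jts.
  by have [ij|ji|//] := ltngtP i j => yi yj; [|apply/esym]; exact: H.
rewrite !in_gap => /andP[_ /implyP yi] /andP[yj _].
have iS : (i.+1 < size ts)%N by exact: leq_ltn_trans jts.
have := lt_trans yj (yi iS); rewrite (lt_sorted_ltn_nth 0 ts_lt) ?inE //.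
by rewrite ltnS leqNgt ij.
Qed.

Lemma gap_gt (R : rcfType) (ts : seq R) (i : nat) (y z : R) :
  {in ts, forall t, z <= t} -> (i < size ts)%N -> y \in gap ts i -> z < y.
Proof.
move=> zts its; rewrite in_gap => /andP[+ _]; apply: le_lt_trans.
exact/zts/mem_nth.
Qed.

Lemma prod_sub_gt_sign (R : realDomainType) (s : seq R) (x : R) :
  {in s, forall r, x < r} -> 0 < (-1) ^+ size s * \prod_(r <- s) (x - r).
Proof.
elim: s => [|r s IH] xs; first by rewrite big_nil mulr1 ltr01.
have xr : 0 < r - x by rewrite subr_gt0 xs ?mem_head.
have -> : (-1) ^+ size (r :: s) * \prod_(t <- r :: s) (x - t) =
          (r - x) * ((-1) ^+ size s * \prod_(t <- s) (x - t)).
  by rewrite big_cons exprS; ring.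
by rewrite mulr_gt0 // IH // => t ts; rewrite xs // inE ts orbT.
Qed.

(** At the root of index i only the product of the differences with the other
    roots survives, and just the larger roots contribute a negative factor. *)
Lemma deriv_prod_XsubC_sign (R : realDomainType) (ts : seq R) (i : nat) :
  sorted <%R ts -> (i < size ts)%N ->
  0 < (-1) ^+ (size ts - i.+1) *
      (\prod_(t <- ts) ('X - t%:P))^`().[ts`_i].
Proof.
move=> ts_lt its; rewrite -size_drop.
have := ts_lt; rewrite -{1 3}(cat_take_drop i ts) (drop_nth 0 its).
set t := ts`_i; set s1 := take i ts; set s2 := drop i.+1 ts.
rewrite lt_sorted_pairwise pairwise_cat /= allrel_consr -!andbA.
move=> /and5P[/allP s1t _ _ /allP ts2 _].
rewrite big_cat big_cons /= mulrCA derivM derivXsubC mul1r hornerD !hornerM.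
rewrite hornerXsubC subrr mul0r addr0 !horner_prod mulrCA.
under eq_bigr do rewrite hornerXsubC.
under [X in _ * (_ * X)]eq_bigr do rewrite hornerXsubC.
rewrite mulr_gt0 ?prod_sub_gt_sign //.
rewrite big_seq prodr_gt0 // => r rs; rewrite subr_gt0; exact: s1t.
Qed.

(** Past its Cauchy bound a polynomial has the sign of its leading
    coefficient, so the intermediate value theorem applies. *)
Lemma root_gt_of_lead_coef (R : rcfType) (p : {poly R}) (x : R) :
  lead_coef p * p.[x] < 0 -> exists2 y, x < y & root p y.
Proof.
move=> px; have p0 : p != 0.
  by apply: contraTneq px => ->; rewrite horner0 mulr0 ltxx.
pose b := Num.max (x + 1) (cauchy_bound p).
have xb : x < b by rewrite lt_max ltrDl ltr01.
have pb : Num.sg p.[b] = Num.sg (lead_coef p).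
  apply: (sgp_pinftyP (ge_cauchy_bound p0)).
  by rewrite in_itv /= andbT le_max lexx orbT.
have [|y /itvP xy ry] := @poly_ivtoo _ p x b (ltW xb).
  by rewrite -sgr_lt0 mulrC sgrM pb -sgrM sgr_lt0.
by exists y; rewrite ?xy.
Qed.

(** The source of all roots.  On ts the signs of q are those of the derivative
    of p: they alternate, and at the last root of p the derivative has the sign of
    p at +oo, which by the hypothesis on leading coefficients is opposite to the
    sign of q at +oo.  A change of sign of q thus occurs in every gap, the unbounded
    one included. *)
Lemma root_in_gap (R : rcfType) (p q : {poly R}) (ts : seq R) (i : nat) :
  sorted <%R ts -> p = lead_coef p *: \prod_(t <- ts) ('X - t%:P) ->
  {in ts, forall t, exists2 e, 0 < e & q.[t] = e * p^`().[t]} ->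
  lead_coef p * lead_coef q < 0 -> (i < size ts)%N ->
  exists2 y, y \in gap ts i & root q y.
Proof.
set c := lead_coef p => ts_lt pE qp lead its.
have q_sign j : (j < size ts)%N ->
    0 < c * ((-1) ^+ (size ts - j.+1) * q.[ts`_j]).
  move=> jts; have [e e0 ->] := qp _ (mem_nth 0 jts).
  have := deriv_prod_XsubC_sign ts_lt jts.
  rewrite pE derivZ hornerZ; set d := _.[_]; set s := _ ^+ _ => sd.
  have -> : c * (s * (e * (c * d))) = c ^+ 2 * e * (s * d) by ring.
  rewrite mulr_gt0 // mulr_gt0 // exprn_even_gt0 //=.
  by apply: contraTneq lead => ->; rewrite mul0r ltxx.
have [iS|iS] := ltnP i.+1 (size ts).
  have [||y yI qy] := @poly_ivtoo _ q ts`_i ts`_i.+1.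
  - by rewrite ltW // (lt_sorted_ltn_nth 0 ts_lt) ?inE.
  - have := mulr_gt0 (q_sign _ its) (q_sign _ iS).
    rewrite -(subnSK iS) exprS.
    set s := _ ^+ _; set u := q.[_]; set v := q.[_].
    have -> : c * (-1 * s * u) * (c * (s * v)) = - ((c * s) ^+ 2 * (u * v)).
      by ring.
    rewrite oppr_gt0 => uv; rewrite ltNge; apply/negP => uv0.
    by move: uv; rewrite ltNge mulr_ge0 ?sqr_ge0.
  - by exists y => //; rewrite in_gap iS /=; move: yI; rewrite in_itv.
have [|y yi qy] := @root_gt_of_lead_coef _ q ts`_i.
  have := q_sign _ its; rewrite (eqP (iS : (size ts - i.+1 == 0)%N)).
  rewrite mul1r => cq; have := lead.
  move: cq; set l := lead_coef q; set u := q.[_] => cu cl.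
  rewrite ltNge; apply/negP => lu; have := nmulr_rlt0 (c * u) cl.
  rewrite cu; have -> : c * l * (c * u) = c ^+ 2 * (l * u) by ring.
  by rewrite ltNge mulr_ge0 ?sqr_ge0.
by exists y => //; rewrite in_gap yi ltnNge iS.
Qed.

(** A polynomial has no more roots than its degree, so choosing one root in
    each of as many disjoint intervals exhausts them.  The intervals are indexed by
    a finite type so that the positive and the negative ones can be treated as the
    two sides of a sum type. *)
Lemma roots_pigeonhole (R : rcfType) (T : finType) (p : {poly R})
    (J : T -> interval R) :
  size p = #|T|.+1 ->
  (forall i j y, y \in J i -> y \in J j -> i = j) ->
  (forall i, exists2 y, y \in J i & root p y) ->
  exists2 f : T -> R, perm_eq (rootsR p) (codom f) & forall i, f i \in J i.
Proof.
move=> sp Jdis Jroot.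
have [f /all_and2[fJ rf]] :
    exists f : T -> R, forall i, f i \in J i /\ root p (f i).
  apply: (@fin_all_exists _ _ (fun i y => y \in J i /\ root p y)) => i.
  by have [y] := Jroot i; exists y.
have p0 : p != 0 by rewrite -size_poly_eq0 sp.
have f_inj : injective f.
  by move=> i j fij; apply: (Jdis i j (f i)); rewrite // fij.
have uf : uniq (codom f) by rewrite map_inj_uniq ?enum_uniq.
have af : all (root p) (codom f) by apply/allP => _ /codomP[i ->].
exists f => //; rewrite perm_sym; apply: uniq_perm => //.
  exact: rootsR_uniq.
apply: (uniq_min_size uf _ _).2.
  by move=> y /(allP af); rewrite rootsR_eq.
rewrite size_codom -ltnS -sp max_poly_roots ?rootsR_uniq //.
by apply/allP => y; rewrite rootsR_eq.
Qed.

Lemma exactly_one_root_codom (R : realType) (T : finType) (p : {poly R})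
    (J : T -> interval R) (f : T -> R) :
  p != 0 -> (forall i j y, y \in J i -> y \in J j -> i = j) ->
  perm_eq (rootsR p) (codom f) -> (forall i, f i \in J i) ->
  forall i, exactly_one_root p (J i).
Proof.
move=> p0 Jdis pf fJ i; exists (f i); split.
  by rewrite -rootsR_eq // (perm_mem pf) codom_f.
move=> y [yi]; rewrite -rootsR_eq // (perm_mem pf) => /codomP[j yE].
by rewrite yE (Jdis i j y) // yE.
Qed.

(** The gaps read from the right along a decreasing list, the last one ending at
    -oo, are mirror images of gaps of the increasing list of opposites, so that the
    negative roots reduce to the polynomial reflected in 0. *)
Lemma in_opp_gap (R : rcfType) (ts : seq R) (i : nat) (y : R) :
  (i < size ts)%N ->
  let zs := [seq - t | t <- ts] in
  (y \in Interval (nth -oo%O [seq BRight z | z <- zs] i.+1) (BLeft zs`_i)) =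
  (- y \in gap ts i).
Proof.
move=> its zs; rewrite in_gap ltrNr -map_comp [zs`_i](nth_map 0) //.
have [iS|iS] := ltnP i.+1 (size ts).
  by rewrite (nth_map 0) // in_itv /= ltrNl andbC.
by rewrite nth_default ?size_map // in_itv /= andbT.
Qed.

(** * Roots of Laguerre polynomials *)

(** Induction with the parameter shifted up by one: the gaps of 0 followed by the
    roots of L_n^(a+1) receive the n + 1 roots of L_(n+1)^a. *)
Lemma laguerre_roots (R : rcfType) (a : R) (n : nat) : -1 < a ->
  size (rootsR (laguerre a n)) = n /\
  {in rootsR (laguerre a n), forall x, 0 < x}.
Proof.
elim: n a => [|n IH] a a1.
  by rewrite laguerreE poly_def big_ord1 expr0 alg_polyC rootsRC.
have [|sz pos] := IH (a + 1); first by lra.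
set L := laguerre (a + 1) n in sz pos.
have L_prod := rootsR_prod (etrans (size_laguerre _ n) (congr1 S (esym sz))).
pose ts := 0 :: rootsR L; pose q := n.+1%:R *: laguerre a n.+1.
have ts_lt : sorted <%R ts.
  by rewrite /= path_min_sorted ?rootsR_sorted //; apply/allP.
have ts_ge : {in ts, forall t, 0 <= t}.
  by move=> t; rewrite inE => /predU1P[->//|/pos/ltW].
have qE : q = 'X * L^`() + ((a + 1)%:P - 'X) * L by exact: laguerre_rodrigues.
have sts : size ts = n.+1 by rewrite /= sz.
have [||i|f pf fJ] := @roots_pigeonhole _ 'I_n.+1 (laguerre a n.+1) (fun i => gap ts i).
- by rewrite size_laguerre card_ord.
- move=> i j y yi yj; apply/val_inj.
  by apply: (gap_disjoint ts_lt _ _ yi yj); rewrite sts.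
- have [||||y yi qy] := @root_in_gap _ ('X * L) q ts i ts_lt; last 1 first.
  + by exists y; rewrite // -(rootZ _ _ (natS_neq0 R n)).
  + by rewrite lead_coefM lead_coefX mul1r big_cons subr0 scalerAr -L_prod.
  + move=> t; rewrite qE derivM derivX mul1r !hornerE inE => /predU1P[->|tL].
      (* at 0 the factor a + 1 is where the bound on the parameter enters *)
      exists (a + 1); first by rewrite -ltrBlDr sub0r.
      by rewrite !mul0r addr0 subr0 add0r.
    have Lt : L.[t] = 0 by apply/rootP; rewrite -rootsR_eq ?laguerre_neq0.
    by exists 1; rewrite ?ltr01 // Lt mulr0 addr0 add0r mul1r.
  + rewrite lead_coefM lead_coefX mul1r lead_coefZ !lead_coef_laguerre exprS.
    rewrite mulN1r mulrCA mulNr !mulrN oppr_lt0 mulrACA -expr2 sqrr_sign mul1r.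
    by rewrite !mulr_gt0 ?invr_gt0 ?ltr0n ?fact_gt0.
  + by rewrite sts.
split; first by rewrite (perm_size pf) size_codom card_ord.
move=> x; rewrite (perm_mem pf) => /codomP[i ->].
by apply: (gap_gt ts_ge _ (fJ i)); rewrite sts.
Qed.

Lemma size_roots_laguerre (R : rcfType) (a : R) (n : nat) : -1 < a ->
  size (laguerre a n) = (size (rootsR (laguerre a n))).+1.
Proof. by move=> a1; rewrite (laguerre_roots n a1).1 size_laguerre. Qed.

(** At x <= 0 each of the n linear factors is negative, and (-1)^n is also the
    sign of the leading coefficient. *)
Lemma laguerre_gt0 (R : rcfType) (a : R) (n : nat) (x : R) :
  -1 < a -> x <= 0 -> 0 < (laguerre a n).[x].
Proof.
move=> a1 x0; have [sz pos] := laguerre_roots n a1.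
rewrite (rootsR_prod (size_roots_laguerre n a1)) hornerZ horner_prod.
under eq_bigr do rewrite hornerXsubC.
rewrite lead_coef_laguerre mulrAC divr_gt0 ?ltr0n ?fact_gt0 //.
rewrite -[X in _ ^+ X]sz; apply: prod_sub_gt_sign => r /pos.
exact: le_lt_trans.
Qed.

(** * The exceptional polynomials *)

(** Both factors L and N = (m + 1) L_(m+1)^(-alpha-2)(-x) are kept whole in this
    form, L N being the term that carries the degree. *)
Lemma laguerreIII_leading_product (R : numFieldType) (alpha : R) (m k : nat) :
  laguerreIII alpha m (m + k.+1) =
  laguerre (alpha + 1) k * (m.+1%:R *: laguerre_opp (- alpha - 2) m.+1)
  - 'X * (laguerre (alpha + 1) k)^`() * laguerre_opp (- alpha - 1) m.
Proof.
have -> : laguerreIII alpha m (m + k.+1) =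
    'X * laguerre (alpha + 2) (k%:Z - 1) * laguerre_opp (- alpha - 1) m
    + m.+1%:R *: (laguerre (alpha + 1) k * laguerre_opp (- alpha - 2) m.+1).
  have kE : (m + k.+1)%:Z - m%:Z - 1 = k.
    by rewrite PoszD [m%:Z + _]addrC addrK -addn1 PoszD addrK.
  by rewrite /laguerreIII {1}addnS kE -{2}kE -[_ - 1 - 1]addrA.
rewrite [RHS]addrC -scalerAr; congr +%R.
case: k => [|k].
  rewrite [X in X^`()]laguerreE poly_def big_ord1 expr0 alg_polyC derivC.
  by rewrite !mulr0 !mul0r oppr0.
rewrite deriv_laguerre mulrN mulNr opprK -addrA.
by rewrite -[k.+1]addn1 PoszD addrK.
Qed.

Lemma laguerre_opp_rodrigues (R : numFieldType) (a : R) (n : nat) :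
  n.+1%:R *: laguerre_opp a n.+1 =
  'X * (laguerre_opp (a + 1) n)^`() + ((a + 1)%:P + 'X) * laguerre_opp (a + 1) n.
Proof.
rewrite /laguerre_opp -comp_polyZ laguerre_rodrigues deriv_comp_opp.
by rewrite comp_polyD !comp_polyM comp_polyB comp_polyC comp_polyX opprK mulNr mulrN.
Qed.

(** The two products with a derivative have opposite signs, so at a root of L or
    of M only the derivative of that same factor remains, times the other one. *)
Lemma laguerreIII_wronskian (R : numFieldType) (alpha : R) (m k : nat) :
  let L := laguerre (alpha + 1) k in
  let M := laguerre_opp (- alpha - 1) m in
  laguerreIII alpha m (m + k.+1) =
  'X * (L * M^`() - L^`() * M) + ((- alpha - 1)%:P + 'X) * (L * M).
Proof.
move=> L M; rewrite laguerreIII_leading_product laguerre_opp_rodrigues.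
have -> : - alpha - 2 + 1 = - alpha - 1 by ring.
by rewrite -/L -/M; ring.
Qed.

(** The product L N alone has degree m + k + 1: in the other term the factor X
    makes up for the degree lost in L', but M has one degree less than N. *)
Lemma size_lead_coef_laguerreIII (R : numFieldType) (alpha : R) (m k : nat) :
  size (laguerreIII alpha m (m + k.+1)) = (m + k.+1).+1 /\
  lead_coef (laguerreIII alpha m (m + k.+1)) = (-1) ^+ k / (k`! * m`!)%:R.
Proof.
rewrite laguerreIII_leading_product; set L := laguerre (alpha + 1) k.
set N := _ *: laguerre_opp _ _; set Q := _ * _ * _.
have sL : size L = k.+1 by exact: size_laguerre.
have sN : size N = m.+2.
  by rewrite size_scale ?natS_neq0 // size_comp_opp size_laguerre.
have L0 : L != 0 by exact: laguerre_neq0.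
have N0 : N != 0 by rewrite -size_poly_eq0 sN.
have sLN : size (L * N) = (m + k.+1).+1.
  by rewrite size_mul // sL sN addSn addnC /= addSnnS.
have sQ : (size (- Q)%R < size (L * N)%R)%N.
  rewrite size_polyN sLN ltnS; apply: leq_trans (size_polyMleq _ _) _.
  rewrite size_comp_opp size_laguerre addnS /= addnC leq_add2l.
  apply: leq_trans (size_polyMleq _ _) _; rewrite size_polyX add2n /=.
  by rewrite -sL lt_size_deriv.
rewrite size_polyDl // lead_coefDl // sLN; split => //.
rewrite lead_coefM lead_coefZ lead_coef_comp_opp size_laguerre.
rewrite !lead_coef_laguerre [X in _ * (_ * X)]mulrAC -expr2 sqrr_sign mul1r.
rewrite natrM factS natrM.
have := natS_neq0 R m; have := fact_neq0 R m; have := fact_neq0 R k.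
by move: m.+1%:R m`!%:R k`!%:R => u v w w0 v0 u0; field; rewrite u0 v0 w0.
Qed.

(* [rootsR p] is the increasing list of all the roots of p.  The lists are
   0-indexed: xs`_i is x_{k-1,i+1} and zs`_i is z_{m,i+1}, so zs decreases.  In
   (a) the left endpoint is 0 for i = 0 and x_{k-1,i} otherwise, and the right
   endpoint is +oo for i = k - 1; in (b) the left endpoint is -oo for
   i = m - 1. *)
Theorem theorem5p5 (R : realType) (m k : nat) (alpha : R)
  (m_gt0 : (0 < m)%N) (k_gt0 : (0 < k)%N) (alpha_bounds : -1 < alpha < 0) :
  let P := laguerreIII alpha m (m + k) in
  let L := laguerre (alpha + 1) k.-1 in
  let M := laguerre_opp (- alpha - 1) m in
  let xs := rootsR L in
  let zs := rev (rootsR M) in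
  [/\ [/\ size xs = k.-1, size zs = m,
          {in xs, forall x, mup x L = 1%N}, {in zs, forall z, mup z M = 1%N}
        & sorted <%R (rev zs ++ 0 :: xs)],
      count (fun y => 0 < y) (rootsR P) = k
        /\ count (fun y => y < 0) (rootsR P) = m,
      forall i : nat, (i < k)%N ->
        exactly_one_root P
          (Interval (BRight (0 :: xs)`_i) (nth +oo%O [seq BLeft x | x <- xs] i))
    & forall i : nat, (i < m)%N ->
        exactly_one_root P
          (Interval (nth -oo%O [seq BRight z | z <- zs] i.+1) (BLeft zs`_i))].
Proof.
case: k k_gt0 => // k _ P L M xs zs; rewrite -pred_Sn in L xs *.
have [alpha_gt alpha_lt] := andP alpha_bounds.
have a_gt : -1 < alpha + 1 by lra.
have b_gt : -1 < - alpha - 1 by lra.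
have b_lt : - alpha - 1 < 0 by lra.
set b := - alpha - 1 in M zs b_gt b_lt *; pose K := laguerre b m.
have [size_xs xs_gt0] := laguerre_roots k a_gt.
have [size_ts ts_gt0] := laguerre_roots m b_gt.
have sizeL := size_roots_laguerre k a_gt.
have sizeK := size_roots_laguerre m b_gt.
rewrite -/L -/xs in size_xs xs_gt0 sizeL; rewrite -/K in size_ts ts_gt0 sizeK.
set ts := rootsR K in size_ts ts_gt0 sizeK.
have zsE : zs = [seq - t | t <- ts] by exact: rev_rootsR_comp_opp.
have size_zs : size zs = m by rewrite zsE size_map.
have zs_lt0 : {in zs, forall z, z < 0}.
  by move=> z; rewrite zsE => /mapP[t /ts_gt0 t0 ->]; rewrite oppr_lt0.
have PE x : P.[x] = x * (L.[x] * M^`().[x] - L^`().[x] * M.[x])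
                    + (b + x) * (L.[x] * M.[x]).
  by rewrite /P laguerreIII_wronskian !hornerE.
have Lx x : x <= 0 -> 0 < L.[x] by exact: laguerre_gt0.
have Mx x : 0 <= x -> 0 < M.[x].
  by move=> x0; rewrite horner_opp laguerre_gt0 // oppr_le0.
have [sizeP leadP] := size_lead_coef_laguerreIII alpha m k.
rewrite -/P in sizeP leadP.
have P0 : P != 0 by rewrite -size_poly_eq0 sizeP.
pose xs0 := 0 :: xs.
have xs0_lt : sorted <%R xs0.
  by rewrite /= path_min_sorted ?rootsR_sorted //; apply/allP.
have xs0_ge : {in xs0, forall t, 0 <= t}.
  by move=> t; rewrite inE => /predU1P[->//|/xs_gt0/ltW].
have ts_lt : sorted <%R ts by exact: rootsR_sorted.
pose J (i : 'I_k.+1 + 'I_m) := match i with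
  | inl i => gap xs0 i
  | inr i => Interval (nth -oo%O [seq BRight z | z <- zs] i.+1) (BLeft zs`_i)
  end.
have J_inr (i : 'I_m) y : (y \in J (inr i)) = (- y \in gap ts i).
  by rewrite /J zsE in_opp_gap // size_ts.
have J_gt0 (i : 'I_k.+1) y : y \in J (inl i) -> 0 < y.
  by apply: gap_gt => //; rewrite /= size_xs.
have J_lt0 (i : 'I_m) y : y \in J (inr i) -> y < 0.
  rewrite J_inr -oppr_gt0; apply: gap_gt; rewrite ?size_ts //.
  by move=> t /ts_gt0/ltW.
have J_disj i j y : y \in J i -> y \in J j -> i = j.
  case: i j => i [] j yi yj.
  - congr inl; apply/val_inj; apply: (gap_disjoint xs0_lt _ _ yi yj);
      by rewrite /= size_xs.
  - by have := lt_trans (J_gt0 _ _ yi) (J_lt0 _ _ yj); rewrite ltxx.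
  - by have := lt_trans (J_gt0 _ _ yj) (J_lt0 _ _ yi); rewrite ltxx.
  - congr inr; apply/val_inj; rewrite !J_inr in yi yj.
    by apply: (gap_disjoint ts_lt _ _ yi yj); rewrite size_ts.
have J_root i : exists2 y, y \in J i & root P y.
  case: i => i; last first.
    (* on the negative side 0 is not added to the list: P does not change sign
       between 0 and the nearest root of M *)
    have [||||y yi Py] := @root_in_gap _ K (P \Po (- 'X)) ts i ts_lt.
    - exact: rootsR_prod.
    - move=> t tK; have t0 := ts_gt0 _ tK.
      exists (t * L.[- t]); first by rewrite mulr_gt0 // Lx // oppr_le0 ltW.
      have Kt : K.[t] = 0 by apply/rootP; rewrite -rootsR_eq ?laguerre_neq0.
      rewrite horner_opp PE deriv_comp_opp hornerN !horner_opp opprK Kt; ring.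
    - rewrite lead_coef_comp_opp sizeP leadP lead_coef_laguerre.
      rewrite /= addnS exprS exprD mulN1r !mulrN oppr_lt0.
      set s := _ ^+ m; set s' := _ ^+ k; set u := _^-1; set v := _^-1.
      have -> : s * u * (s' * v * (s * s')) = s ^+ 2 * s' ^+ 2 * (u * v) by ring.
      by rewrite !sqrr_sign !mul1r mulr_gt0 // invr_gt0 ltr0n ?muln_gt0 !fact_gt0.
    - by rewrite size_ts.
    exists (- y); first by rewrite J_inr opprK.
    by rewrite /root -horner_opp.
  have [||||y yi] := @root_in_gap _ ('X * L) (- P) xs0 i xs0_lt.
  - by rewrite lead_coefM lead_coefX mul1r big_cons subr0 scalerAr -rootsR_prod.
  - move=> t; rewrite hornerN PE derivM derivX mul1r hornerD hornerM hornerX inE.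
    move=> /predU1P[->|tL].
      (* b < 0 is what makes P negative at 0 and puts a root before those of L *)
      exists (- b * M.[0]); last by ring.
      by rewrite mulr_gt0 ?oppr_gt0 ?Mx.
    have Lt : L.[t] = 0 by apply/rootP; rewrite -rootsR_eq ?laguerre_neq0.
    by exists M.[t]; [rewrite Mx // ltW // xs_gt0 | rewrite Lt; ring].
  - rewrite lead_coefM lead_coefX mul1r lead_coefN leadP lead_coef_laguerre.
    rewrite mulrN oppr_lt0 mulrACA -expr2 sqrr_sign mul1r.
    by rewrite -invfM invr_gt0 -natrM ltr0n !muln_gt0 !fact_gt0.
  - by rewrite /= size_xs.
  by rewrite rootN; exists y.
have [|f Pf fJ] := roots_pigeonhole _ J_disj J_root.
  by rewrite sizeP card_sum !card_ord addnC.
have J_one := exactly_one_root_codom P0 J_disj Pf fJ.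
split.
- split=> //.
  + by move=> x; exact: mup_rootsR.
  + move=> z; rewrite mem_rev; apply: mup_rootsR.
    by rewrite size_comp_opp sizeK size_ts -size_zs size_rev.
  + rewrite revK lt_sorted_pairwise pairwise_cat -!lt_sorted_pairwise.
    rewrite rootsR_sorted xs0_lt !andbT; apply/allrelP => z x zM.
    move=> /xs0_ge; apply: lt_le_trans; apply: zs_lt0; by rewrite mem_rev.
- have count_roots a : count a (rootsR P) =
      (\sum_(i < k.+1 | a (f (inl i))) 1 + \sum_(i < m | a (f (inr i))) 1)%N.
    by rewrite (permP Pf) count_map -sum1_count big_enum_cond /= big_sumType.
  have f_gt0 i : 0 < f (inl i) by exact/J_gt0/fJ.
  have f_lt0 i : f (inr i) < 0 by exact/J_lt0/fJ.
  rewrite !count_roots; split.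
    rewrite (eq_bigl xpredT) // sum1_card card_ord big_pred0 ?addn0 // => i.
    by rewrite lt_gtF.
  rewrite big_pred0 => [|i]; last by rewrite lt_gtF.
  by rewrite add0n (eq_bigl xpredT) // sum1_card card_ord.
- by move=> i ik; have := J_one (inl (Ordinal ik)).
- by move=> i im; have := J_one (inr (Ordinal im)).
Qed.
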